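(* Let $(A,\mathrm F,\theta=\ell_0,d=\ell_1,\ell_2,\ell_3,\dots)$ be a complete shifted curved $\mathcal L_\infty$-algebra over a field of characteristic $0$, encoded by a Maurer–Cartan element $\alpha$, and let $a\in \mathrm F_1A_0$. The gauge action $e^{-a}\cdot\alpha$ produces the following (twisted) shifted curved $\mathcal L_\infty$-algebra structure on $A$: $$\ell_n^a=\sum_{k\ge0}\frac1{k!}\,\ell_{k+n}\big(a^k,-,\dots,-\big),\qquad n\ge0 .$$
   Context: Complete graded module: graded module with a decreasing filtration $A=\mathrm F_0A\supset \mathrm F_1A\supset\cdots$ with $A\cong\lim_kA/\mathrm F_kA$. $\hom(A^{\odot n},A)$ denotes filtration preserving graded symmetric $n$-linear maps ($A^{\odot n}$: coinvariants of $A^{\otimes n}$ under $\mathbb S_n$). The complete left-unital pre-Lie algebra is $\mathfrak a=\prod_{n\ge0}\hom(A^{\odot n},A)$ (zero differential), the convolution algebra of the cooperad $\mathrm{uCom}^*$ (linear dual of the operad of unital commutative algebras) with $\mathrm{end}_A$: $(f\star g)_n=\sum_{p+q=n}\sum_{\sigma}(f_{p+1}\circ_1g_q)^\sigma$, where $\sigma$ runs over the inverses of $(q,p)$-shuffles, i.e. one sums over all choices of $q$ of the $n$ inputs to be fed into $g_q$ (Koszul signs); left unit $1=\mathrm{id}_A$. A complete shifted curved $\mathcal L_\infty$-algebra structure on $A$ is a Maurer–Cartan element $\alpha=(\ell_0,\ell_1,\ell_2,\dots)$ of $\mathfrak a$, i.e. a degree $-1$ element with $\alpha\star\alpha=0$.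 The gauge action is $e^\lambda\cdot\alpha=(e^\lambda\star\alpha)\circledcirc e^{-\lambda}$, where $e^\lambda=1+\sum_{n\ge1}\frac1{n!}(\cdots(\lambda\star\lambda)\cdots)\star\lambda$ and $x\circledcirc(1+b)=\sum_{n\ge0}\frac1{n!}\{x;b,\dots,b\}$ with symmetric braces $\{x;\}=x$, $\{x;b_1\}=x\star b_1$, $\{x;b_1,\dots,b_n\}=\{\{x;b_1,\dots,b_{n-1}\};b_n\}-\sum_{i<n}\{x;b_1,\dots,\{b_i;b_n\},\dots,b_{n-1}\}$ for $b_i$ of degree $0$. An element $a\in \mathrm F_1A_0$ is viewed as the element of $\mathfrak a$ concentrated in arity $0$, so $e^{\pm a}=1\pm a$. *)

(* Defs.v *)
From mathcomp Require Import all_boot all_order all_algebra.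
From mathcomp Require Import boolp classical_sets.

Set Implicit Arguments.
Unset Strict Implicit.
Unset Printing Implicit Defensive.

Import Order.TTheory GRing.Theory Num.Theory.
Local Open Scope ring_scope.

(* Completeness is the bijectivity of the canonical map from A to
   lim_m A/F_m A, degree by degree: [cg_sep] is its injectivity and [cg_lim]
   its surjectivity, a point of the limit being a sequence of representatives
   u m with u m.+1 = u m modulo F_m. *)
Record cgmod (k : fieldType) := CGMod {
  cg_car :> int -> lmodType k;
  cg_fil : nat -> forall i : int, set (cg_car i);
  cg_fil0 : forall i (x : cg_car i), cg_fil 0 x;
  cg_filS : forall m i (x : cg_car i), cg_fil m.+1 x -> cg_fil m x;
  cg_fil_zero : forall m i, cg_fil m (0 : cg_car i);
  cg_fil_lin : forall m i (c : k) (x y : cg_car i),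
    cg_fil m x -> cg_fil m y -> cg_fil m (c *: x + y);
  cg_sep : forall i (x : cg_car i), (forall m, cg_fil m x) -> x = 0;
  cg_lim : forall i (u : nat -> cg_car i),
    (forall m, cg_fil m (u m.+1 - u m)) ->
    exists x, forall m, cg_fil m (x - u m) }.

Section Convolution.
Variables (k : fieldType) (A : cgmod k).

(* Homogeneous elements, carrying their degree. *)
Definition homog := {i : int & A i}.

Definition hel (i : int) (x : A i) : homog := Tagged (fun i => A i) x.

Definition deg (xs : seq homog) : int := \sum_(x <- xs) tag x.

(* The degree j component of a homogeneous element: itself if j is its degree,
   and 0 otherwise. *)
Definition hcomp (x : homog) (j : int) : A j := tagged_as (hel (0 : A j)) x.

(* A family (f_n)_n of maps from A^n to A: f_n is the restriction of f to the
   words of length n, and f xs j is the degree j component of f_n(xs). *)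
Definition cochain := seq homog -> forall j : int, A j.

Definition has_degree (d : int) (f : cochain) : Prop :=
  forall xs j, j != deg xs + d -> f xs j = 0.

Definition multilinear (f : cochain) : Prop :=
  forall xs ys i (c : k) (u v : A i) j,
    f (xs ++ hel (c *: u + v) :: ys) j =
    c *: f (xs ++ hel u :: ys) j + f (xs ++ hel v :: ys) j.

(* Invariance under the adjacent transpositions, which generate the action of
   the symmetric groups with its Koszul signs. *)
Definition graded_symmetric (f : cochain) : Prop :=
  forall xs ys (u v : homog) j,
    f (xs ++ u :: v :: ys) j =
    (-1) ^ (tag u * tag v) *: f (xs ++ v :: u :: ys) j.

(* f_n sends F_{m_1} x ... x F_{m_n} to F_{m + m_1 + ... + m_n}; the word s
   lists the pairs (m_i, x_i). *)
Definition conv_fil (m : nat) (f : cochain) : Prop :=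
  forall s : seq (nat * homog),
    (forall p, p \in s -> cg_fil p.1 (tagged p.2)) ->
    forall j, cg_fil (m + sumn (unzip1 s))%N (f (unzip2 s) j).

(* The degree d elements of the product of the hom(A^{(.)n}, A). *)
Definition conv (d : int) (f : cochain) : Prop :=
  [/\ has_degree d f, multilinear f, graded_symmetric f & conv_fil 0 f].

Definition czero : cochain := fun _ _ => 0.
Definition cadd (f g : cochain) : cochain := fun xs j => f xs j + g xs j.
Definition copp (f : cochain) : cochain := fun xs j => - f xs j.
Definition cscale (c : k) (f : cochain) : cochain := fun xs j => c *: f xs j.

(* The left unit id_A, in arity 1. *)
Definition cone : cochain :=
  fun xs j => if xs is [:: x] then hcomp x j else 0.

(* A degree 0 element of A, in arity 0. *)
Definition arity0 (a : A 0) : cochain :=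
  fun xs j => if xs is [::] then hcomp (hel a) j else 0.

(* The Koszul sign of reordering xs into the letters selected by m followed by
   the others: each unselected letter is jumped over by the selected letters
   to its right. *)
Fixpoint ksign (m : bitseq) (xs : seq homog) : k :=
  match m, xs with
  | true :: m', _ :: xs' => ksign m' xs'
  | false :: m', x :: xs' => (-1) ^ (tag x * deg (mask m' xs')) * ksign m' xs'
  | _, _ => 1
  end.

(* The pre-Lie product of f with an element g of degree e; the letters
   selected by the mask m are the inputs of g.  As g stands in the first slot
   of f, it contributes no further sign. *)
Definition star (e : int) (f g : cochain) : cochain := fun xs j =>
  \sum_(m : (size xs).-tuple bool)
    let ys := mask m xs in
    let zs := mask (map negb m) xs in
    ksign m xs *: f (hel (g ys (deg ys + e)) :: zs) j.

(* Symmetric braces with entries of degree 0; in [brace_rec] the entries are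
   listed from last to first, and n is their number. *)
Fixpoint brace_rec (n : nat) (x : cochain) (bs : seq cochain) : cochain :=
  match n, bs with
  | n'.+1, b :: bs' => fun xs j =>
      star 0 (brace_rec n' x bs') b xs j
      - \sum_(i < size bs')
          brace_rec n' x (set_nth b bs' i (star 0 (nth b bs' i) b)) xs j
  | _, _ => x
  end.

Definition brace (x : cochain) (bs : seq cochain) : cochain :=
  brace_rec (size bs) x (rev bs).

(* Convergence of series for the filtration [conv_fil]. *)
Definition csum_to (u : nat -> cochain) (s : cochain) : Prop :=
  forall m, exists N, forall n, (N <= n)%N ->
    conv_fil m (fun xs j => s xs j - \sum_(i < n) u i xs j).

Definition summable (u : nat -> cochain) : Prop := exists s, csum_to u s.

(* The sum of a series, which is unique by [cg_sep]; 0 if it diverges. *)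
Definition csum (u : nat -> cochain) : cochain :=
  if pselect (summable u) is left h then sval (cid h) else czero.

(* The terms of e^lambda - 1, starting with the one of exponent 1. *)
Definition exp_series (lambda : cochain) (n : nat) : cochain :=
  cscale (n.+1)`!%:R^-1 (iter n (fun x => star 0 x lambda) lambda).

Definition expm1 (lambda : cochain) : cochain := csum (exp_series lambda).

(* The terms and the sum of the circle product of x with 1 + b. *)
Definition circ_series (x b : cochain) (n : nat) : cochain :=
  cscale n`!%:R^-1 (brace x (nseq n b)).

Definition circ (x b : cochain) : cochain := csum (circ_series x b).

(* e^lambda * alpha, for alpha of degree -1. *)
Definition exp_star (lambda alpha : cochain) : cochain :=
  star (-1) (cadd cone (expm1 lambda)) alpha.

Definition gauge (lambda alpha : cochain) : cochain :=
  circ (exp_star lambda alpha) (expm1 (copp lambda)).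

(* All the series in the definition of [gauge] converge. *)
Definition gauge_defined (lambda alpha : cochain) : Prop :=
  [/\ summable (exp_series lambda), summable (exp_series (copp lambda))
    & summable (circ_series (exp_star lambda alpha) (expm1 (copp lambda)))].

(* Complete shifted curved L_infinity-algebra structures on A, as
   Maurer-Cartan elements. *)
Definition curvedLinf (alpha : cochain) : Prop :=
  conv (-1) alpha /\ star (-1) alpha alpha = czero.

End Convolution.

(* Main.v *)
Require Import Defs.
From mathcomp Require Import all_boot all_order all_algebra.
From mathcomp Require Import boolp classical_sets.

Set Implicit Arguments.
Unset Strict Implicit.
Unset Printing Implicit Defensive.

Import Order.TTheory GRing.Theory Num.Theory.
Local Open Scope ring_scope.

(** A degree 0 element a acts on cochains by the operator [insert a], which
    feeds a into the first slot.  The gauge action of e^(-a) turns out to be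
    the exponential of this operator, and it preserves Maurer-Cartan elements
    because the operator is a derivation.

    As an element of arity 0 has no input to compose into, c * c = 0, so that
    e^(-a) = 1 - a and e^a = 1 + a.  For the same reason (1 - a) * alpha = alpha
    ([star_cone_arity0]), and only the circle product with 1 + a matters.  There
    f * a is [insert a f], and the correction terms in the recursion for the
    braces contain a * a = 0; so {alpha; a, ..., a} is an iterate of [insert a]
    on alpha ([brace_arity0]), and the gauge action yields the Taylor series
    sum_n (insert a)^n alpha / n!, which is the announced formula.

    Convergence comes from a being in F_1: the n-th term raises the filtration
    by n ([conv_fil_taylor]).  Such series converge uniformly
    ([csum_to_exists]), and their sums inherit degree, multilinearity and
    symmetry ([csum_to_conv]).

    The twisted structure is again a Maurer-Cartan element because [insert a]
    is a derivation of the pre-Lie product ([insert_star]), so that its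
    exponential is multiplicative.  Leibniz' rule gives this degree by degree
    ([taylor_star]), and the continuity of the product ([csum_to_star]) lets it
    pass to the sum: L * L is the Taylor series of alpha * alpha = 0. *)

(** * Masks and sequences *)

Lemma sumn_mask (m : bitseq) (s : seq nat) : size m = size s ->
  (sumn (mask m s) + sumn (mask (map negb m) s))%N = sumn s.
Proof.
elim: m s => [|b m IHm] [|x s] //= [/IHm] <-.
by case: b => /=; [rewrite addnA|rewrite addnCA].
Qed.

(** The inductive step for sums over all choices of inputs, such as the one
    defining the pre-Lie product: the first input is selected or not. *)
Lemma big_tuple_cons (V : nmodType) n (F : bitseq -> V) :
  \sum_(m : n.+1.-tuple bool) F m =
  \sum_(m : n.-tuple bool) F (true :: m) +
  \sum_(m : n.-tuple bool) F (false :: m).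
Proof.
rewrite (reindex (fun p : bool * n.-tuple bool => [tuple of p.1 :: p.2])) /=.
  by rewrite -(pair_bigA _ (fun b (m : n.-tuple bool) => F (b :: m))) big_bool.
exists (fun m => (thead m, [tuple of behead m])) => [[b m] _|m _] /=.
  by congr pair; apply: val_inj.
by apply: val_inj; rewrite /= [in RHS](tuple_eta m).
Qed.

Lemma set_nth_map (T1 T2 : Type) (h : T1 -> T2) x0 y0 (s : seq T1) i y :
  (i < size s)%N -> set_nth x0 (map h s) i (h y) = map h (set_nth y0 s i y).
Proof. by elim: s i => [|z s IHs] [|i] //= /IHs ->. Qed.

(** * The filtration *)

Section Filtration.
Variables (k : fieldType) (A : cgmod k).
Implicit Types (i : int) (m n : nat).

Lemma cg_filZ m i (c : k) (x : A i) : cg_fil m x -> cg_fil m (c *: x).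
Proof.
by move=> xm; rewrite -[_ *: x]addr0; apply: cg_fil_lin => //; apply: cg_fil_zero.
Qed.

Lemma cg_filD m i (x y : A i) : cg_fil m x -> cg_fil m y -> cg_fil m (x + y).
Proof. by move=> xm ym; rewrite -[x]scale1r; apply: cg_fil_lin. Qed.

Lemma cg_filN m i (x : A i) : cg_fil m x -> cg_fil m (- x).
Proof. by rewrite -scaleN1r; apply: cg_filZ. Qed.

Lemma cg_filB m i (x y : A i) : cg_fil m x -> cg_fil m y -> cg_fil m (x - y).
Proof. by move=> xm ym; apply/cg_filD/cg_filN. Qed.

Lemma cg_fil_sum m i I (r : seq I) (P : pred I) (F : I -> A i) :
  (forall t, P t -> cg_fil m (F t)) -> cg_fil m (\sum_(t <- r | P t) F t).
Proof.
move=> Fm; elim/big_ind: _ => //; first exact: cg_fil_zero.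
by move=> x y; apply: cg_filD.
Qed.

Lemma cg_fil_le m n i (x : A i) : (m <= n)%N -> cg_fil n x -> cg_fil m x.
Proof.
move=> /subnK <-; elim: (n - m)%N => // d IHd xd; apply: IHd.
by apply: cg_filS; rewrite -addSn.
Qed.

End Filtration.

Section Cochains.
Variables (k : fieldType) (A : cgmod k).
Implicit Types (f g s : cochain A) (u : nat -> cochain A).
Implicit Types (xs ys : seq (homog A)).

Lemma cochainP f g : (forall xs j, f xs j = g xs j) -> f = g.
Proof. by move=> fg; apply/funext => xs; apply/functional_extensionality_dep. Qed.

Lemma multilinear0 f xs ys i j : multilinear f ->
  f (xs ++ hel (0 : A i) :: ys) j = 0.
Proof.
move=> /(_ xs ys i 1 0 0 j); rewrite !scale1r addr0 => /esym/eqP.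
by rewrite -subr_eq0 addrK => /eqP.
Qed.

Lemma multilinear_mem0 f ws i j : multilinear f ->
  hel (0 : A i) \in ws -> f ws j = 0.
Proof. by move=> fl /splitPr[xs ys]; apply: multilinear0. Qed.

Lemma conv_fil_le m n f : (m <= n)%N -> conv_fil n f -> conv_fil m f.
Proof.
move=> mn fn s sP j; apply: cg_fil_le (fn s sP j).
by rewrite leq_add2r.
Qed.

Lemma conv_fil_add m f g : conv_fil m f -> conv_fil m g -> conv_fil m (cadd f g).
Proof. by move=> fm gm s sP j; apply: cg_filD; [apply: fm|apply: gm]. Qed.

Lemma conv_fil_scale m c f : conv_fil m f -> conv_fil m (cscale c f).
Proof. by move=> fm s sP j; apply: cg_filZ; apply: fm. Qed.

Lemma conv_fil_sum m n (u : 'I_n -> cochain A) : (forall i, conv_fil m (u i)) ->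
  conv_fil m (fun xs j => \sum_(i < n) u i xs j).
Proof. by move=> um s sP j; apply: cg_fil_sum => i _; apply: um. Qed.

(** Every input lies in F_0, so a filtration level of a cochain bounds all its
    values; this reduces questions on cochains to the
    separation and completeness of A. *)
Lemma conv_fil_at m f xs j : conv_fil m f -> cg_fil m (f xs j).
Proof.
move=> fm; have := fm [seq (0%N, x) | x <- xs] _ j.
have -> : unzip2 [seq (0%N, x) | x <- xs] = xs.
  by rewrite /unzip2 -map_comp map_id_in.
have -> : sumn (unzip1 [seq (0%N, x) | x <- xs]) = 0%N by elim: (xs).
by rewrite addn0; apply=> p /mapP[x _ ->]; apply: cg_fil0.
Qed.

(** * Convergence *)

Lemma csum_to_at u s xs j m : csum_to u s ->
  exists N, forall n, (N <= n)%N ->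
    cg_fil m (s xs j - \sum_(i < n) u i xs j).
Proof. by move=> /(_ m)[N uN]; exists N => n /uN /conv_fil_at. Qed.

Lemma csum_to_unique u s s' : csum_to u s -> csum_to u s' -> s = s'.
Proof.
move=> us us'; apply: cochainP => xs j; apply/eqP; rewrite -subr_eq0.
apply/eqP/cg_sep => m.
have [N sN] := csum_to_at xs j m us; have [N' sN'] := csum_to_at xs j m us'.
have := cg_filB (sN _ (leq_maxl N N')) (sN' _ (leq_maxr N N')).
by rewrite opprB addrA subrK.
Qed.

Lemma csum_eq u s : csum_to u s -> csum u = s.
Proof.
move=> us; rewrite /csum; case: pselect => [h|]; last by case; exists s.
by apply: csum_to_unique us; apply: svalP.
Qed.

Lemma csum_to_first u : (forall n, u n.+1 = @czero _ A) -> csum_to u (u 0%N).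
Proof.
move=> u0 m; exists 1%N => -[//|n] _ s _ j.
rewrite big_ord_recl big1 ?addr0 ?subrr; first exact: cg_fil_zero.
by move=> i _; rewrite lift0 u0.
Qed.

(** The limit is taken value by value, with the completeness of A.  The point is
    that the remainder s - sum_(i < n) u_i still raises the filtration by n on
    inputs of positive filtration: on such inputs one compares with a partial
    sum so late that its remainder is deep enough for trivial reasons, and each
    of the finitely many terms in between is in filtration n. *)
Lemma csum_to_exists u : (forall n, conv_fil n (u n)) ->
  exists s, forall n, conv_fil n (fun xs j => s xs j - \sum_(i < n) u i xs j).
Proof.
move=> uF.
have ex xs j : exists x, forall n, cg_fil n (x - \sum_(i < n) u i xs j).
  apply: cg_lim => n; rewrite big_ord_recr /= addrAC subrr add0r.
  exact: conv_fil_at.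
pose s : cochain A := fun xs j => sval (cid (ex xs j)).
exists s => n w wF j; set xs := unzip2 w.
(* F_M is the filtration that the claim requires on the word w. *)
set M := (n + sumn (unzip1 w))%N.
have sM : cg_fil M (s xs j - \sum_(i < M) u i xs j) 
  by exact: (svalP (cid (ex xs j))).
have nM : (n <= M)%N by apply: leq_addr.
have -> : s xs j - \sum_(i < n) u i xs j =
    (s xs j - \sum_(i < M) u i xs j) + \sum_(n <= i < M) u i xs j.
  rewrite -!(big_mkord predT (fun i => u i xs j)) (big_cat_nat (leq0n n) nM) //=.
  by rewrite opprD addrA subrK.
apply: cg_filD => //; rewrite big_seq; apply: cg_fil_sum => i.
by rewrite mem_index_iota => /andP[ni _]; apply: (conv_fil_le ni).
Qed.

(** Degree, multilinearity and symmetry are identities between finitely many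
    values, so they pass to the limit by the separation of the filtration.  For
    the filtration, s is a partial sum plus a remainder in filtration 0. *)
Lemma csum_to_conv d u s :
  (forall n, conv d (u n)) -> csum_to u s -> conv d s.
Proof.
move=> uc us; split.
- move=> xs j dj; apply: cg_sep => m.
  have [N /(_ _ (leqnn N))] := csum_to_at xs j m us.
  by rewrite big1 ?subr0 // => i _; case: (uc i) => + _ _ _; apply.
- move=> xs ys i c x y j; apply/eqP; rewrite -subr_eq0; apply/eqP/cg_sep => m.
  set X := xs ++ hel (c *: x + y) :: ys; set Y := xs ++ hel x :: ys.
  set Z := xs ++ hel y :: ys.
  have [N1 h1] := csum_to_at X j m us; have [N2 h2] := csum_to_at Y j m us.
  have [N3 h3] := csum_to_at Z j m us.
  pose N := maxn N1 (maxn N2 N3).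
  have {}h1 := h1 N (leq_maxl _ _).
  have {}h2 := h2 N (leq_trans (leq_maxl _ _) (leq_maxr _ _)).
  have {}h3 := h3 N (leq_trans (leq_maxr _ _) (leq_maxr _ _)).
  have := cg_filB h1 (cg_fil_lin c h2 h3).
  have -> : \sum_(i < N) u i X j =
      c *: \sum_(i < N) u i Y j + \sum_(i < N) u i Z j.
    rewrite scaler_sumr -big_split; apply: eq_bigr => l _.
    by case: (uc l) => _ + _ _; apply.
  by rewrite scalerBr addrACA -opprD opprB addrA subrK.
- move=> xs ys x y j; apply/eqP; rewrite -subr_eq0; apply/eqP/cg_sep => m.
  set X := xs ++ x :: y :: ys; set Y := xs ++ y :: x :: ys; set c := _ ^ _.
  have [N1 h1] := csum_to_at X j m us; have [N2 h2] := csum_to_at Y j m us.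
  pose N := maxn N1 N2.
  have {}h1 := h1 N (leq_maxl _ _).
  have {}h2 := cg_filZ c (h2 N (leq_maxr _ _)).
  have := cg_filB h1 h2.
  have -> : \sum_(i < N) u i X j = c *: \sum_(i < N) u i Y j.
    rewrite scaler_sumr; apply: eq_bigr => l _.
    by case: (uc l) => _ _ + _; apply.
  by rewrite scalerBr opprB addrA subrK.
- have [N /(_ _ (leqnn N)) sN] := us 0%N.
  have {1}-> : s = cadd (fun xs j => s xs j - \sum_(i < N) u i xs j)
                    (fun xs j => \sum_(i < N) u i xs j).
    by apply: cochainP => xs j; rewrite /cadd subrK.
  apply: conv_fil_add => //; apply: conv_fil_sum => i.
  by case: (uc i).
Qed.

(** * The pre-Lie product *)

Lemma starZl e c f g xs j : star e (cscale c f) g xs j = c *: star e f g xs j.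
Proof.
rewrite /star scaler_sumr; apply: eq_bigr => m _.
by rewrite /cscale !scalerA mulrC.
Qed.

Lemma starBl e f u n g xs j :
  star e (fun xs j => f xs j - \sum_(i < n) u i xs j) g xs j =
  star e f g xs j - \sum_(i < n) star e (u i) g xs j.
Proof.
rewrite /star exchange_big -sumrB; apply: eq_bigr => m _.
by rewrite scalerBr scaler_sumr.
Qed.

Lemma multilinear_sub f xs ys i n (x : A i) (F : 'I_n -> A i) j :
  multilinear f ->
  f (xs ++ hel (x - \sum_(i < n) F i) :: ys) j =
  f (xs ++ hel x :: ys) j - \sum_(i < n) f (xs ++ hel (F i) :: ys) j.
Proof.
move=> fl; rewrite addrC -scaleN1r fl scaleN1r addrC; congr (_ - _).
elim: n F => [|n IHn] F; first by rewrite !big_ord0 multilinear0.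
by rewrite !big_ord_recl -[F ord0]scale1r fl !scale1r IHn.
Qed.

Lemma starBr e f g u n xs j : multilinear f ->
  star e f (fun xs j => g xs j - \sum_(i < n) u i xs j) xs j =
  star e f g xs j - \sum_(i < n) star e f (u i) xs j.
Proof.
move=> fl; rewrite /star exchange_big -sumrB; apply: eq_bigr => m _.
by rewrite (@multilinear_sub _ [::]) // scalerBr scaler_sumr.
Qed.

Lemma starZr e c f g xs j : multilinear f ->
  star e f (cscale c g) xs j = c *: star e f g xs j.
Proof.
move=> fl; rewrite /star scaler_sumr; apply: eq_bigr => m _.
rewrite /cscale -[c *: g _ _]addr0 (fl [::]) /= (@multilinear0 _ [::]) //.
by rewrite addr0 !scalerA mulrC.
Qed.

(** Whichever inputs are given to g, their filtrations and those of the inputs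
    left to f add up to the total ([sumn_mask]). *)
Lemma conv_fil_star e m n f g :
  conv_fil m f -> conv_fil n g -> conv_fil (m + n) (star e f g).
Proof.
move=> fm gn s sF j; apply: cg_fil_sum => t _; apply: cg_filZ.
have st : size t = size s by rewrite size_tuple size_map.
rewrite /= /unzip2 -!map_mask.
set y := g _ _.
have yF : cg_fil (n + sumn (unzip1 (mask t s))) y.
  by apply: gn => p /mem_mask; apply: sF.
have := fm ((n + sumn (unzip1 (mask t s)), hel y)%N :: mask (map negb t) s) _ j.
rewrite -(@sumn_mask t (unzip1 s)); last by rewrite st size_map.
rewrite /unzip1 -!map_mask /= !addnA.
apply=> p; rewrite inE => /predU1P[-> //|/mem_mask]; exact: sF.
Qed.

(** The pre-Lie product is continuous in both variables, in the form of a Cauchy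
    product.  Cutting along the triangle p + q < n makes the remainder
    f * (g - g_n) + sum_p (f - f_(n - p)) * v_p, where f_n and g_n are the partial
    sums, and every summand is visibly in filtration n. *)
Lemma csum_to_star e u v f g :
    multilinear f -> conv_fil 0 f -> (forall n, conv_fil n (v n)) ->
    (forall n, conv_fil n (fun xs j => f xs j - \sum_(i < n) u i xs j)) ->
    (forall n, conv_fil n (fun xs j => g xs j - \sum_(i < n) v i xs j)) ->
  csum_to (fun n xs j => \sum_(p < n.+1) star e (u (n - p)%N) (v p) xs j)
    (star e f g).
Proof.
move=> fl f0 vF fu gv m; exists m => n mn; apply: (conv_fil_le mn).
have -> : (fun xs j => star e f g xs j -
      \sum_(i < n) \sum_(p < i.+1) star e (u (i - p)%N) (v p) xs j) =
    cadd (star e f (fun xs j => g xs j - \sum_(p < n) v p xs j))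
      (fun xs j => \sum_(p < n)
         star e (fun xs j => f xs j - \sum_(q < n - p) u q xs j) (v p) xs j).
  apply: cochainP => xs j; rewrite /cadd /= starBr // -addrA; congr (_ + _).
  under [X in _ = _ + X]eq_bigr do rewrite starBl.
  rewrite sumrB addrA addNr add0r; congr (- _).
  elim: (n) => [|N IHN]; first by rewrite !big_ord0.
  rewrite [LHS]big_ord_recr IHN.
  under [in RHS]eq_bigr => p _ do
    rewrite subSn -1?ltnS ?ltn_ord // big_ord_recr /=.
  by rewrite big_split /= [in RHS]big_ord_recr /= subnn big_ord0 addr0.
apply: conv_fil_add; first exact: (conv_fil_star e f0 (gv n)).
apply: conv_fil_sum => p.
have := conv_fil_star e (fu (n - p)%N) (vF p).
by rewrite subnK // ltnW.
Qed.

Lemma mask_eq_nil (m : bitseq) xs : size m = size xs -> mask m xs = [::] ->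
  m = nseq (size xs) false.
Proof. by elim: m xs => [|[] m IHm] [|x xs] //= [/IHm IH] /IH <-. Qed.

(** * Inserting a degree 0 element *)

Definition insert (a : A 0) f : cochain A := fun xs j => f (hel a :: xs) j.

Lemma iter_insertE a n f xs j :
  iter n (insert a) f xs j = f (nseq n (hel a) ++ xs) j.
Proof. by elim: n f => // n IHn f; rewrite iterSr IHn. Qed.

Lemma deg_hel0 (a : A 0) xs : deg (hel a :: xs) = deg xs.
Proof. by rewrite /deg big_cons add0r. Qed.

Lemma insert_conv d a f : conv d f -> conv d (insert a f).
Proof.
case=> fd fl fs f0; split.
- by move=> xs j dj; apply: fd; rewrite deg_hel0.
- by move=> xs ys; apply: (fl (hel a :: xs)).
- by move=> xs ys; apply: (fs (hel a :: xs)).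
- move=> s sF j; apply: (f0 ((0%N, hel a) :: s)) => p.
  by rewrite inE => /predU1P[->|/sF //]; apply: cg_fil0.
Qed.

Lemma conv_fil_insert m a f :
  cg_fil 1 a -> conv_fil m f -> conv_fil m.+1 (insert a f).
Proof.
move=> a1 fm s sF j; rewrite addSnnS; apply: (fm ((1%N, hel a) :: s)) => p.
by rewrite inE => /predU1P[->|/sF //].
Qed.

(** The derivation property: a is either among the inputs of g or among those of
    f.  In the second case it comes after g in the slots of f and has to be moved
    to the front; this costs no sign because a has degree 0. *)
Lemma insert_star e a f g : graded_symmetric f ->
  insert a (star e f g) =
  cadd (star e (insert a f) g) (star e f (insert a g)).
Proof.
move=> fs; apply: cochainP => xs j; rewrite /insert /star /cadd /=.
rewrite (@big_tuple_cons _ _ (fun m => ksign m (hel a :: xs) *: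
  f (hel (g (mask m (hel a :: xs)) (deg (mask m (hel a :: xs)) + e))
    :: mask (map negb m) (hel a :: xs)) j)) addrC.
congr (_ + _); apply: eq_bigr => m _ /=; last by rewrite deg_hel0.
by rewrite mul0r mul1r (fs [::]) /= mulr0 scale1r.
Qed.

Lemma iter_insert_star e a n f g xs j :
    graded_symmetric f ->
  iter n (insert a) (star e f g) xs j =
  \sum_(p < n.+1)
    star e (iter (n - p) (insert a) f) (iter p (insert a) g) xs j *+ 'C(n, p).
Proof.
move=> fs; have its q : graded_symmetric (iter q (insert a) f).
  by elim: q => //= q IHq ys zs; apply: (IHq (hel a :: ys)).
elim: n xs j => [|n IHn] xs j; first by rewrite big_ord1.
pose T p q := star e (iter q (insert a) f) (iter p (insert a) g) xs j.
transitivity (\sum_(p < n.+1) (T p (n - p).+1 + T p.+1 (n - p)%N) *+ 'C(n, p)).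
  rewrite iterS [LHS]IHn; apply: eq_bigr => p _; congr (_ *+ _).
  by have /(congr1 (fun h => h xs j)) := insert_star e a (iter p (insert a) g)
       (its (n - p)%N).
under eq_bigr do rewrite mulrnDl.
rewrite [RHS]big_ord_recl big_split.
under [in RHS]eq_bigr do rewrite lift0 binS mulrnDr subSS.
rewrite [in RHS]big_split /= addrA; congr (_ + _).
(* What is left of Pascal's rule matches up to a shift of p: the term p = 0 of
   one sum is the isolated one, and the last term of the other has 'C(n, n.+1). *)
rewrite [LHS]big_ord_recl [in RHS]big_ord_recr /=.
rewrite (@bin_small n n.+1) // mulr0n addr0 !bin0 subn0.
congr (_ + _); apply: eq_bigr => p _.
by rewrite /bump add1n subnSK.
Qed.

(** * The twisting series *)

Definition taylor (a : A 0) f n : cochain A :=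
  cscale n`!%:R^-1 (iter n (insert a) f).

(** Multiplicativity of the exponential of a derivation: after division by n! the
    binomial coefficients of Leibniz' rule are absorbed in the two factors. *)
Lemma taylor_star e a n f g xs j :
    [pchar k] =i pred0 -> graded_symmetric f -> multilinear f ->
  taylor a (star e f g) n xs j =
  \sum_(p < n.+1) star e (taylor a f (n - p)) (taylor a g p) xs j.
Proof.
move=> /pcharf0P charE fs fl; have itl q : multilinear (iter q (insert a) f).
  by elim: q => //= q IHq ys zs; apply: (IHq (hel a :: ys)).
have binz q : (q <= n)%N -> 'C(n, q)%:R != 0 :> k.
  by move=> qn; rewrite charE -lt0n bin_gt0.
rewrite /taylor /cscale iter_insert_star // scaler_sumr.
apply: eq_bigr => -[p /= pn] _.
rewrite starZl starZr // !scalerA -scaler_nat scalerA; congr (_ *: _).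
rewrite -(@bin_fact n p) // !natrM invfM mulrAC mulVf ?binz //.
by rewrite mul1r invfM mulrC.
Qed.

Lemma taylor_conv d a f n : conv d f -> conv d (taylor a f n).
Proof.
move=> fc; have [gd gl gs g0] : conv d (iter n (insert a) f).
  by elim: n => //= n; apply: insert_conv.
split.
- by move=> xs j dj; rewrite /taylor /cscale gd // scaler0.
- move=> xs ys i c x y j; rewrite /taylor /cscale gl scalerDr !scalerA.
  by rewrite mulrC.
- move=> xs ys x y j; rewrite /taylor /cscale gs !scalerA.
  by rewrite mulrC.
- exact: conv_fil_scale.
Qed.

Lemma conv_fil_taylor a f n :
  cg_fil 1 a -> conv_fil 0 f -> conv_fil n (taylor a f n).
Proof.
move=> a1 f0; apply: conv_fil_scale.
by elim: n => //= n; apply: conv_fil_insert.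
Qed.

(** * The gauge action of an element of arity 0 *)

Lemma hcomp_id i (x : A i) : hcomp (hel x) i = x.
Proof. exact: (@tagged_asE _ (fun i => A i) (hel (0 : A i)) x). Qed.

Lemma hcomp_neq (x : homog A) j : tag x != j -> hcomp x j = 0.
Proof. by rewrite /hcomp /tagged_as /= eq_sym; case: eqP. Qed.

Lemma hcomp0 i j : hcomp (hel (0 : A i)) j = 0.
Proof.
case: (eqVneq i j) => [ij|ij]; last by rewrite hcomp_neq.
by case: j / ij; rewrite hcomp_id.
Qed.

Lemma arity0N (a : A 0) : copp (arity0 (- a)) = arity0 a.
Proof.
apply: cochainP => -[|x xs] j; last by rewrite /copp /= oppr0.
rewrite /copp /=; case: (eqVneq 0 j) => [j0|j0].
  by case: j / j0; rewrite !hcomp_id opprK.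
by rewrite !hcomp_neq ?oppr0.
Qed.

Lemma arity0_0 : arity0 (0 : A 0) = @czero _ A.
Proof. by apply: cochainP => -[|x xs] j //=; rewrite hcomp0. Qed.

Lemma star_arity0l e (a : A 0) g : star e (arity0 a) g = @czero _ A.
Proof. by apply: cochainP => xs j; apply: big1 => m _; exact: scaler0. Qed.

Lemma ksign_nseq b xs : ksign (nseq (size xs) b) xs = 1.
Proof.
elim: xs => //= x xs IHxs; case: b IHxs => //= ->.
by rewrite mask_false /deg big_nil mulr0 mulr1.
Qed.

(** An arity 0 element can only receive the empty set of inputs; every other
    choice contributes f (0, ...) = 0. *)
Lemma star_arity0r a f : multilinear f -> star 0 f (arity0 a) = insert a f.
Proof.
move=> fl; apply: cochainP => xs j.
rewrite /star (bigD1 [tuple of nseq (size xs) false]) //= big1 ?addr0.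
  rewrite ksign_nseq scale1r mask_false map_nseq mask_true //.
  by rewrite /deg big_nil /arity0 hcomp_id.
move=> m; rewrite -val_eqE /=.
case E: (mask m xs) => [|y ys]; last by rewrite (@multilinear0 _ [::]) ?scaler0.
by rewrite (mask_eq_nil _ E) ?size_tuple // eqxx.
Qed.

(** The correction terms of the recursion replace an entry c_i by c_i * c, which
    is 0 as c_i has no input; the induction hypothesis applied to the entries
    with c_i replaced by 0 makes them vanish, by multilinearity.  This is why
    the statement is for arbitrary entries and not only for n copies of a. *)
Lemma brace_rec_arity0 f (cs : seq (A 0)) xs j : multilinear f ->
  brace_rec (size cs) f (map (@arity0 k A) cs) xs j =
  f (catrev (map (@hel k A 0) cs) xs) j.
Proof.
move=> fl; move E: (size cs) => n.
elim: n cs E xs j => [|n IHn] [|c cs] //= [E] xs j.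
(* [star_arity0r] needs the shorter brace to be multilinear, which the
   induction hypothesis reads off from f. *)
have bl : multilinear (brace_rec n f (map (@arity0 k A) cs)).
  by move=> ys zs i d u v l; rewrite !IHn // !catrevE !catA; apply: fl.
rewrite star_arity0r // /insert IHn // big1 ?subr0 // => -[i /= ics] _.
rewrite size_map in ics.
rewrite (nth_map 0) // star_arity0l -arity0_0 (set_nth_map _ _ (0 : A 0)) // IHn.
  apply: (@multilinear_mem0 f _ 0) => //.
  rewrite catrevE mem_cat mem_rev map_f //; apply/(nthP 0); exists i.
    by rewrite size_set_nth leq_max ltnSn.
  by rewrite nth_set_nth /= eqxx.
by rewrite size_set_nth E; apply/maxn_idPr; rewrite -E.
Qed.

Lemma brace_arity0 a f n : multilinear f ->
  brace f (nseq n (arity0 a)) = iter n (insert a) f.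
Proof.
move=> fl; apply: cochainP => xs j; rewrite iter_insertE /brace.
have := brace_rec_arity0 (nseq n a) xs j fl.
by rewrite !map_nseq catrevE !rev_nseq !size_nseq.
Qed.

(** As c * c = 0, the exponential of c is 1 + c. *)
Lemma csum_to_exp_arity0 (c : A 0) :
  csum_to (exp_series (arity0 c)) (arity0 c).
Proof.
have e1 : exp_series (arity0 c) 0 = arity0 c.
  by apply: cochainP => xs j; rewrite /exp_series /cscale invr1 scale1r.
rewrite -[X in csum_to _ X]e1; apply: csum_to_first => n.
apply: cochainP => xs j; rewrite /exp_series iterSr star_arity0l.
have -> : iter n (fun x => star 0 x (arity0 c)) (@czero k A) = @czero k A.
  by elim: n => // n IHn; rewrite iterS IHn -{1}arity0_0 star_arity0l.
exact: scaler0.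
Qed.

(** Composing with the identity in arity 1 requires that g takes all the inputs,
    and the arity 0 element has no slot for g. *)
Lemma star_cone_arity0 e c g : has_degree e g ->
  star e (cadd (@cone k A) (arity0 c)) g = g.
Proof.
move=> gd; apply: cochainP => xs j.
rewrite /star (bigD1 [tuple of nseq (size xs) true]) //= big1 ?addr0.
  rewrite ksign_nseq scale1r map_nseq mask_false mask_true // /cadd /= addr0.
  case: (eqVneq (deg xs + e) j) => [<-|dj]; first by rewrite hcomp_id.
  by rewrite hcomp_neq // gd // eq_sym.
move=> m; rewrite -val_eqE /= => mT.
case E: (mask (map negb m) xs) => [|y ys].
  have /(congr1 (map negb)) := mask_eq_nil (etrans (size_map _ _) (size_tuple m)) E.
  rewrite map_nseq -map_comp map_id_in => [mE|b _ /=]; last exact: negbK.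
  by rewrite mE eqxx in mT.
by rewrite /cadd /= addr0 scaler0.
Qed.

Lemma circ_series_arity0 a f : multilinear f ->
  circ_series f (arity0 a) = taylor a f.
Proof. by move=> fl; apply/funext => n; rewrite /circ_series brace_arity0. Qed.

Lemma exp_star_arity0 c f : has_degree (-1) f -> exp_star (arity0 c) f = f.
Proof.
move=> fd; rewrite /exp_star /expm1 (csum_eq (csum_to_exp_arity0 c)).
exact: star_cone_arity0.
Qed.

Lemma expm1_arity0N (a : A 0) : expm1 (copp (arity0 (- a))) = arity0 a.
Proof. by rewrite arity0N; apply/csum_eq/csum_to_exp_arity0. Qed.

Lemma gauge_arity0 a f : has_degree (-1) f -> multilinear f ->
  gauge (arity0 (- a)) f = csum (taylor a f).
Proof.
move=> fd fl.
by rewrite /gauge exp_star_arity0 // expm1_arity0N /circ circ_series_arity0.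
Qed.

Lemma gauge_defined_arity0 a f : has_degree (-1) f -> multilinear f ->
  summable (taylor a f) -> gauge_defined (arity0 (- a)) f.
Proof.
move=> fd fl tf; split.
- by eexists; apply: csum_to_exp_arity0.
- by rewrite arity0N; eexists; apply: csum_to_exp_arity0.
- by rewrite exp_star_arity0 // expm1_arity0N circ_series_arity0.
Qed.

End Cochains.

Theorem proposition4p14 (k : fieldType) (hk : [pchar k] =i pred0)
    (A : cgmod k) (alpha : cochain A) (halpha : curvedLinf alpha)
    (a : A 0) (ha : cg_fil 1 a) :
  [/\ gauge_defined (arity0 (- a)) alpha,
      curvedLinf (gauge (arity0 (- a)) alpha)
    & csum_to
        (fun m xs j => m`!%:R^-1 *: alpha (nseq m (hel a) ++ xs) j)
        (gauge (arity0 (- a)) alpha)].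
Proof.
case: halpha => alphac alpha2; have [alphad alphal alphas alpha0] := alphac.
have tF n : conv_fil n (taylor a alpha n) by apply: conv_fil_taylor.
have [L LF] := csum_to_exists tF.
have tL : csum_to (taylor a alpha) L.
  by move=> m; exists m => n mn; apply: conv_fil_le (LF n).
have gL : gauge (arity0 (- a)) alpha = L by rewrite gauge_arity0 // (csum_eq tL).
have Lc : conv (-1) L by apply: csum_to_conv tL => n; apply: taylor_conv.
have [_ Ll _ L0] := Lc.
split; first by apply: gauge_defined_arity0 => //; exists L.
- rewrite gL; split=> //; apply: csum_to_unique (csum_to_star (-1) Ll L0 tF LF LF) _.
  have -> : (fun n xs j => \sum_(p < n.+1)
      star (-1) (taylor a alpha (n - p)) (taylor a alpha p) xs j) =
      fun=> @czero k A.
    apply/funext => n; apply: cochainP => xs j.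
    rewrite -taylor_star // alpha2 /taylor /cscale iter_insertE.
    exact: scaler0.
  exact: (@csum_to_first _ _ (fun=> @czero k A)).
- rewrite gL; congr csum_to: tL; apply/funext => n; apply: cochainP => xs j.
  by rewrite /taylor /cscale iter_insertE.
Qed.
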